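(* Let $X,Y,Z,W$ be locally convex Hausdorff topological vector spaces, $K\subset Y$ a proper closed convex cone with $\operatorname{int}K\ne\emptyset$, $P\subset W$ and $S\subset Z$ nonempty convex cones, $F\colon X\to Y^\infty$, $\kappa\colon W\to Y^\infty$, $H\colon X\to W^\infty$, $G\colon X\to Z^\infty$ proper mappings, $C\subset X$ nonempty, $A=C\cap G^{-1}(-S)$, and assume $A\cap\operatorname{dom}F\cap H^{-1}(\operatorname{dom}\kappa)\neq\emptyset$. Put $$\mathcal M^1=\bigcup_{T_1\in\operatorname{dom}\kappa^*,\; T_2\in\mathcal L_+^w(S,K)}\Psi\big(\mathfrak E\mathrm{pi}(F+T_1\circ H+T_2\circ G+I_C)^*\boxplus\{(0_{\mathcal L},\kappa^*(T_1)\uplus I_{-S}^*(T_2))\}\big),$$ $$\mathcal M^1_+=\bigcup_{T_1\in\operatorname{dom}\kappa^*\cap\mathcal L_+(P,K),\; T_2\in\mathcal L_+(S,K)}\Psi\big(\mathfrak E\mathrm{pi}(F+T_1\circ H+T_2\circ G+I_C)^*\boxplus\{(0_{\mathcal L},\kappa^*(T_1))\}\big).$$ Consider the statements: $(\mathrm a_1)$ $\operatorname{epi}(F+\kappa\circ H+I_A)^*=\mathcal M^1$; $(\mathrm b_1)$ $\operatorname{epi}(F+\kappa\circ H+I_A)^*=\mathcal M^1_+$; $(\mathrm e_1)$ stable strong duality holds for $(\mathrm{CCVP})-(\mathrm{CCVD}^1)$: for every $L\in\mathcal L(X,Y)$, $\operatorname{WInf}\{F(x)+(\kappa\circ H)(x)-L(x):x\in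 A\}=\operatorname{WMax}D_L$, where $$D_L=\bigcup_{T_1\in\operatorname{dom}\kappa^*,\; T_2\in\mathcal L_+^w(S,K)}\operatorname{WInf}\{F(x)-L(x)+(T_1\circ H)(x)+(T_2\circ G)(x)+\kappa(w)-T_1(w)+T_2(s):x\in C,\,w\in W,\,s\in S\};$$ $(\mathrm f_1)$ stable strong duality holds for $(\mathrm{CCVP})-(\mathrm{CCVD}^1_\ell)$: for every $L\in\mathcal L(X,Y)$, $\operatorname{WInf}\{F(x)+(\kappa\circ H)(x)-L(x):x\in A\}=\operatorname{WMax}D_L^+$, where $$D_L^+=\bigcup_{T_1\in\operatorname{dom}\kappa^*\cap\mathcal L_+(P,K),\; T_2\in\mathcal L_+(S,K)}\operatorname{WInf}\{F(x)-L(x)+(T_1\circ H)(x)+(T_2\circ G)(x)+\kappa(w)-T_1(w):x\in C,\,w\in W\}.$$ Then $(\mathrm a_1)\Leftrightarrow(\mathrm e_1)$ and $(\mathrm b_1)\Leftrightarrow(\mathrm f_1)$.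
   Context: Ordering: $K$ proper means $K\neq Y$. $y_1<_K y_2$ iff $y_1-y_2\in-\operatorname{int}K$. $Y^\infty=Y\cup\{+\infty_Y\}$, $Y^\bullet=Y\cup\{\pm\infty_Y\}$, with $-\infty_Y<_Ky<_K+\infty_Y$ for $y\in Y$, $-\infty_Y<_K+\infty_Y$, $-(\pm\infty_Y)=\mp\infty_Y$, $y+(+\infty_Y)=+\infty_Y$ for $y\in Y^\infty$, $M+\{+\infty_Y\}=\{+\infty_Y\}$ for $M\subset Y$; similarly $W^\infty=W\cup\{+\infty_W\}$, $Z^\infty=Z\cup\{+\infty_Z\}$. For $M\subset Y^\bullet$: $\operatorname{WSup}M$ is the set of $\bar v\in Y^\bullet$ such that $\bar v\not<_Kv$ for all $v\in M$ and for every $\tilde v\in Y^\bullet$ with $\tilde v<_K\bar v$ there is $v\in M$ with $\tilde v<_Kv$; $\operatorname{WInf}M=-\operatorname{WSup}(-M)$; $\operatorname{WMax}M=M\cap\operatorname{WSup}M$. A mapping into $Y^\infty$ (or $W^\infty$, $Z^\infty$) is proper if its domain (set of points where it is not $+\infty$) is nonempty. $\kappa(+\infty_W)=+\infty_Y$. For $T\in\mathcal L(Z,Y)$ (continuous linear maps), $(T\circ G)(x)=T(G(x))$ if $G(x)\in Z$ and $+\infty_Y$ otherwise; likewise $T\circ H$. $I_D(x)=0_Y$ if $x\in D$, $+\infty_Y$ otherwise. $0_{\mathcal L}$ is the zero of $\mathcal L(X,Y)$. $\mathcal L_+(S,K)=\{T\in\mathcal L(Z,Y):T(S)\subset K\}$,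 $\mathcal L_+^w(S,K)=\{T\in\mathcal L(Z,Y):T(S)\cap(-\operatorname{int}K)=\emptyset\}$, and $\mathcal L_+(P,K)$ is defined analogously. Conjugates: for $E\colon X\to Y^\infty$, $E^*(L)=\operatorname{WSup}\{L(x)-E(x):x\in X\}$, $\operatorname{dom}E^*=\{L:E^*(L)\neq\{+\infty_Y\}\}$, $\operatorname{epi}E^*=\{(L,y)\in\mathcal L(X,Y)\times Y:y\in E^*(L)+K\}$; likewise for mappings on $W$, $Z$ ($\kappa^*$, $I_{-S}^*$). Set order: for nonempty $M,N\subset Y^\bullet$, $M\preccurlyeq_KN$ iff $v\not<_Ku$ for all $u\in M$, $v\in N$. $\mathcal P_p(Y)$ is the collection of $U\subset Y$ such that $Y$ is the disjoint union of $U-\operatorname{int}K$, $U$, $U+\operatorname{int}K$; $\mathcal P_p(Y)^\infty=\mathcal P_p(Y)\cup\{\{+\infty_Y\}\}$. For $U,V\in\mathcal P_p(Y)^\infty$, $U\uplus V=\operatorname{WSup}(U+V)$. Extended epigraph: $\mathfrak E\mathrm{pi}E^*=\{(L,U)\in\mathcal L(X,Y)\times\mathcal P_p(Y):L\in\operatorname{dom}E^*,\ E^*(L)\preccurlyeq_KU\}$. $\mathscr M\boxplus\mathscr N=\{(L_1+L_2,U_1\uplus U_2):(L_1,U_1)\in\mathscr M,(L_2,U_2)\in\mathscr N\}$. $\Psi$ is the set-valued map from $\mathcal L(X,Y)\times\mathcal P_p(Y)$ to $\mathcal L(X,Y)\times Y$ given by $\Psi(L,U)=\{L\}\times U$, and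 $\Psi(\mathscr M)=\bigcup_{(L,U)\in\mathscr M}\Psi(L,U)$. $(\mathrm{CCVP})$ is the problem $\operatorname{WInf}\{F(x)+(\kappa\circ H)(x):x\in C,\ G(x)\in-S\}$; $(\mathrm{CCVD}^1)$ and $(\mathrm{CCVD}^1_\ell)$ are its Lagrange and loose Lagrange duals, obtained from $D_L$ and $D_L^+$ with $L=0_{\mathcal L}$.
   Formalization: (a₁)⇔(e₁) is asserted if dom(F+κ∘H+I_A)^* or dom κ^* is nonempty, and (b₁)⇔(f₁) if dom(F+κ∘H+I_A)^* or dom κ^*∩L_+(P,K) is nonempty; otherwise (a₁), (b₁) hold as ∅=∅ while (e₁), (f₁) fail. *)

(* Defs.v *)
From HB Require Import structures.
From mathcomp Require Import all_boot all_order all_algebra.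
From mathcomp Require Import all_classical all_reals all_analysis.

Set Implicit Arguments.
Unset Strict Implicit.
Unset Printing Implicit Defensive.

Import Order.TTheory GRing.Theory Num.Theory.
Import numFieldNormedType.Exports.

Local Open Scope classical_set_scope.
Local Open Scope ring_scope.

Record clinear (R : realType) (X Y : tvsType R) := CLinear {
  clinear_fun :> X -> Y ;
  clinear_linear : linear clinear_fun ;
  clinear_continuous : continuous clinear_fun }.

Section ContinuousLinear.
Context (R : realType) (X Y : tvsType R).

HB.instance Definition _ (L : clinear X Y) :=
  GRing.isLinear.Build R X Y *:%R (L : X -> Y) (clinear_linear L).

Lemma clinear_eq (L1 L2 : clinear X Y) : L1 =1 L2 -> L1 = L2.
Proof.
case: L1 L2 => [f1 l1 c1] [f2 l2 c2] /= /funext f12.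
by subst f2; congr CLinear; exact: Prop_irrelevance.
Qed.

Fact clinear0_linear : linear (fun _ : X => 0 : Y).
Proof. by move=> a x y; rewrite scaler0 addr0. Qed.

Definition clinear0 : clinear X Y := CLinear clinear0_linear (@cst_continuous X Y 0).

Fact clinearD_linear (L1 L2 : clinear X Y) : linear (fun x => L1 x + L2 x).
Proof. by move=> a x y; rewrite !linearP scalerDr addrACA. Qed.

Fact clinearD_continuous (L1 L2 : clinear X Y) :
  continuous (fun x => L1 x + L2 x).
Proof.
move=> x.
apply: (@continuous_comp _ _ _ (fun x => (L1 x, L2 x))
  (fun y : Y * Y => y.1 + y.2)); last exact: add_continuous.
by apply: cvg_pair; exact: clinear_continuous.
Qed.

Definition clinearD (L1 L2 : clinear X Y) : clinear X Y :=
  CLinear (@clinearD_linear L1 L2) (@clinearD_continuous L1 L2).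

End ContinuousLinear.

(** [0] need not belong to a cone: only positive multiples are required. *)
Definition cone (R : realType) (V : tvsType R) (S : set V) :=
  forall (t : R) v, 0 < t -> S v -> S (t *: v).

Definition convex_cone (R : realType) (V : tvsType R) (S : set V) :=
  cone S /\ convex_set (S : set (convex_lmodType V)).

Section PositiveMaps.
Context (R : realType) (Y Z : tvsType R).

Definition Lplus (S : set Z) (K : set Y) : set (clinear Z Y) :=
  [set T | T @` S `<=` K].

Definition Lplusw (S : set Z) (K : set Y) : set (clinear Z Y) :=
  [set T | (T @` S) `&` (-%R @` K°) = set0].

End PositiveMaps.

(** Mappings into [V] completed with [+oo] are modelled by functions into
    [\bar V] that do not take the value [-oo], a condition that is part of
    [proper_map].  [+oo] and [-oo] never get added. *)

Section ExtendedMaps.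
Context (T : Type) (V : Type).

Definition dom (f : T -> \bar V) : set T := [set t | f t <> +oo%E].

Definition proper_map (f : T -> \bar V) :=
  (forall t, f t <> -oo%E) /\ dom f !=set0.

End ExtendedMaps.

(** [comp_ext k H] is [k \o H], with value [+oo] where [H] is not finite. *)
Definition comp_ext (T V U : Type) (k : V -> \bar U) (H : T -> \bar V) :
    T -> \bar U :=
  fun t => if H t is v%:E then k v else +oo%E.

Definition compl_ext (T V U : Type) (L : V -> U) (G : T -> \bar V) :
    T -> \bar U :=
  comp_ext (fun v => (L v)%:E) G.

Definition preimage_ext (T V : Type) (f : T -> \bar V) (D : set V) : set T :=
  f @^-1` (EFin @` D).

Definition indic_ext (T : Type) (Y : nmodType) (D : set T) : T -> \bar Y :=
  fun t => if t \in D then (0 : Y)%:E else +oo%E.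

Section VectorOrder.
Context (R : realType) (Y : tvsType R).
Variable K : set Y.

Definition ltK (u v : \bar Y) : Prop :=
  match u, v with
  | a%:E, b%:E => (-%R @` K°) (a - b)
  | a%:E, +oo%E => True
  | -oo%E, b%:E => True
  | -oo%E, +oo%E => True
  | _, _ => False
  end.

Definition WSup (M : set (\bar Y)) : set (\bar Y) :=
  [set v | (forall m, M m -> ~ ltK v m) /\
           (forall u, ltK u v -> exists2 m, M m & ltK u m)].

Definition WInf (M : set (\bar Y)) : set (\bar Y) :=
  -%E @` WSup (-%E @` M).

Definition WMax (M : set (\bar Y)) : set (\bar Y) := M `&` WSup M.

Definition sum_set (V : nmodType) (M N : set (\bar V)) : set (\bar V) :=
  [set (u + v)%E | u in M & v in N].

Definition preceqK (M N : set (\bar Y)) : Prop :=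
  forall u v, M u -> N v -> ~ ltK v u.

Definition uplus (U V : set (\bar Y)) : set (\bar Y) := WSup (sum_set U V).

Definition Pp : set (set Y) := [set U : set Y |
  let Um := [set u - k | u in U & k in K°] in
  let Up := [set u + k | u in U & k in K°] in
  [/\ Um `|` U `|` Up = setT,
      Um `&` U = set0, Um `&` Up = set0 & U `&` Up = set0]].

Section Conjugate.
Context (V : tvsType R).
Implicit Type E : V -> \bar Y.

Definition conj E (L : clinear V Y) : set (\bar Y) :=
  WSup [set ((L x)%:E - E x)%E | x in [set: V]].

Definition domconj E : set (clinear V Y) := [set L | conj E L <> [set +oo%E]].

Definition epiconj E : set (clinear V Y * Y) :=
  [set p | sum_set (conj E p.1) (EFin @` K) p.2%:E].

(** The second components are elements of [Pp], seen as subsets of [\bar Y]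
    so that [uplus] applies to them. *)
Definition Epiconj E : set (clinear V Y * set (\bar Y)) :=
  [set p | domconj E p.1 /\
           exists U, [/\ Pp U, p.2 = EFin @` U & preceqK (conj E p.1) p.2]].

Definition boxplus (M N : set (clinear V Y * set (\bar Y))) :
    set (clinear V Y * set (\bar Y)) :=
  [set (clinearD p.1 q.1, uplus p.2 q.2) | p in M & q in N].

(** [uplus] may take the value [[set +oo]], for which [Psi] is empty. *)
Definition Psi (p : clinear V Y * set (\bar Y)) : set (clinear V Y * Y) :=
  [set q | q.1 = p.1 /\ p.2 q.2%:E].

Definition PsiS (M : set (clinear V Y * set (\bar Y))) : set (clinear V Y * Y) :=
  \bigcup_(p in M) Psi p.

End Conjugate.
End VectorOrder.

Section Composite.
Context (R : realType) (X Y Z W : tvsType R).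
Variables (K : set Y) (P : set W) (S : set Z).
Variables (F : X -> \bar Y) (kappa : W -> \bar Y).
Variables (H : X -> \bar W) (G : X -> \bar Z) (C : set X).

Definition feasible : set X := C `&` preimage_ext G (-%R @` S).

Definition primal_map : X -> \bar Y :=
  fun x => (F x + comp_ext kappa H x + indic_ext Y feasible x)%E.

Definition lagrange_map (T1 : clinear W Y) (T2 : clinear Z Y) : X -> \bar Y :=
  fun x => (F x + compl_ext T1 H x + compl_ext T2 G x + indic_ext Y C x)%E.

Definition M1 : set (clinear X Y * Y) :=
  \bigcup_(T1 in domconj K kappa) \bigcup_(T2 in Lplusw S K)
    PsiS (boxplus K (Epiconj K (lagrange_map T1 T2))
      [set (clinear0 X Y,
            uplus K (conj K kappa T1)
                    (conj K (indic_ext Y (-%R @` S)) T2))]).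

Definition M1plus : set (clinear X Y * Y) :=
  \bigcup_(T1 in domconj K kappa `&` Lplus P K) \bigcup_(T2 in Lplus S K)
    PsiS (boxplus K (Epiconj K (lagrange_map T1 T2))
      [set (clinear0 X Y, conj K kappa T1)]).

Definition primal_value (L : clinear X Y) : set (\bar Y) :=
  WInf K [set (F x + comp_ext kappa H x - (L x)%:E)%E | x in feasible].

Definition dual_set (L : clinear X Y) : set (\bar Y) :=
  \bigcup_(T1 in domconj K kappa) \bigcup_(T2 in Lplusw S K)
    WInf K [set e | exists x w s, [/\ C x, S s &
      e = (F x - (L x)%:E + compl_ext T1 H x + compl_ext T2 G x
           + kappa w - (T1 w)%:E + (T2 s)%:E)%E]].

Definition loose_dual_set (L : clinear X Y) : set (\bar Y) :=
  \bigcup_(T1 in domconj K kappa `&` Lplus P K) \bigcup_(T2 in Lplus S K)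
    WInf K [set e | exists x w, C x /\
      e = (F x - (L x)%:E + compl_ext T1 H x + compl_ext T2 G x
           + kappa w - (T1 w)%:E)%E].

Definition stable_strong_duality : Prop :=
  forall L : clinear X Y, primal_value L = WMax K (dual_set L).

Definition loose_stable_strong_duality : Prop :=
  forall L : clinear X Y, primal_value L = WMax K (loose_dual_set L).

End Composite.

(* Main.v *)
Require Import Defs.
From mathcomp Require Import all_boot all_order all_algebra.
From mathcomp Require Import all_classical all_reals all_analysis.
From mathcomp Require Import ring lra.

(** Weak suprema are frontiers of open lower sets: if [below M] is the set of
    points strictly below some element of [M], then [WSup M] is the frontier of
    [below M], and every open lower set is the [below] of its frontier. Let
    [E] be the primal map, [D L] the open lower set of [E^*(L)] and [N T L] that
    of the opposite Lagrangian values for the multipliers [T]. Then [epi E^*] is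
    the complement of [D], and the right-hand side of the epigraph identity is
    the union over [T] of the complements of the [N T]. Weak duality is
    [D L `<=` N T L], so the identity says that each [y] outside [D L] is outside
    some [N T L]. For fixed [L], and if there is some [T], this amounts to
    strong duality: when it holds, a frontier point of [D L] is a frontier point
    of some [N T L], and a maximal point of the dual set cannot come from a
    frontier point of [N T L] that lies strictly above a point outside [D L]. *)

Set Implicit Arguments.
Unset Strict Implicit.
Unset Printing Implicit Defensive.

Import Order.TTheory GRing.Theory Num.Theory.
Import numFieldNormedType.Exports.

Local Open Scope classical_set_scope.
Local Open Scope ring_scope.

(** * Translations and small multiples in a topological vector space *)

Section Translations.
Context (R : realType) (Y : tvsType R).

Lemma nbhs_addr (a b : Y) (U : set Y) :
  nbhs (a + b) U -> nbhs a [set x | U (x + b)].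
Proof.
move=> /(@add_continuous Y (a, b)) [[A B] /= [Aa Bb] AB].
apply: filterS Aa => x Ax.
by apply: (AB (x, b)); split => //; exact: nbhs_singleton.
Qed.

Lemma nbhs0_scale (z : Y) (U : set Y) :
  nbhs (0 : Y) U -> exists2 e : R, 0 < e & U (e *: z).
Proof.
rewrite -(scale0r z) => /(@scale_continuous _ Y (0, z)) [[A B] /= [A0 Bz] AB].
have [e /= e0 he] := A0; exists (e / 2); first exact: divr_gt0.
apply: (AB (e / 2, z)); split; last exact: nbhs_singleton.
by apply: he => /=; rewrite sub0r normrN gtr0_norm ?divr_gt0//; lra.
Qed.

End Translations.

(** * Convex cones with nonempty interior *)

Section ConvexCone.
Context (R : realType) (Y : tvsType R) (K : set Y).
Hypothesis K_cone : convex_cone K.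

Lemma convex_coneD a b : K a -> K b -> K (a + b).
Proof.
move: K_cone => [Kc Kx] Ka Kb.
(* The sum is twice the midpoint of [a] and [b]: convexity gives the midpoint, the cone property the
   doubling. *)
have h : (0 <= 2^-1 :> R) /\ (2^-1 <= 1 :> R) by split; lra.
have := Kx a b (Itv01 h.1 h.2) (mem_set Ka) (mem_set Kb).
move=> /set_mem; rewrite /conv /= => /(Kc 2 _ (ltr0n _ 2)).
rewrite scalerDr !scalerA divff//= /unstable.onem.
have -> : 2 * (1 - 2^-1) = 1 :> R by field.
by rewrite !scale1r.
Qed.

(** A neighbourhood of [a] inside [K], translated by [b], stays inside [K]. *)
Lemma interior_coneD a b : K° a -> K b -> K° (a + b).
Proof.
rewrite /interior /= => Ia Kb.
have : nbhs (a + b) [set x | K (x - b)] by apply: nbhs_addr; rewrite addrK.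
by apply: filterS => x Kx; rewrite -(subrK b x); exact: convex_coneD.
Qed.

Lemma interior_coneZ t a : 0 < t -> K° a -> K° (t *: a).
Proof.
rewrite /interior /= => t0 Ia.
apply: filterS (nbhsZ (lt0r_neq0 t0) Ia) => _ [x Kx <-].
exact: (K_cone.1).
Qed.

Lemma interior_absorbing a z : K° a -> exists2 e : R, 0 < e & K° (a - e *: z).
Proof.
move=> Ia; have : nbhs (0 : Y) [set x | K° (x + a)].
  by apply: nbhs_addr; rewrite add0r; exact: nbhs_interior.
by move=> /(nbhs0_scale (- z)) [e e0]; rewrite /= scalerN addrC; exists e.
Qed.

Hypothesis K_proper : K <> [set: Y].

(** Otherwise [K] would absorb every [z], and so contain it after rescaling. *)
Lemma interior_cone0 : ~ K° 0.
Proof.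
move=> I0; apply: K_proper; apply/seteqP; split => // z _.
have [e e0] := interior_absorbing (- z) I0.
rewrite scalerN opprK add0r => /interior_subset Kz.
rewrite -(scalerK (lt0r_neq0 e0) z).
by apply: (K_cone.1) => //; rewrite invr_gt0.
Qed.

Hypothesis K_closed : closed K.
Hypothesis K_int : interior K !=set0.

(** The origin is the limit of the multiples [e *: k] of an interior point as [e] tends to 0. *)
Lemma closed_cone0 : K 0.
Proof.
have [k Ik] := K_int; apply: K_closed => B /(nbhs0_scale k) [e e0 Be].
by exists (e *: k); split=> //; apply: (K_cone.1) => //; exact: interior_subset.
Qed.

End ConvexCone.

(** * Open lower sets, their frontiers and their sums *)

Section LowerSets.
Context (R : realType) (Y : tvsType R) (K : set Y).

(** The equivalence encodes [D = D - K°]: right to left is downward closure, left to right is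
    openness. *)
Definition lower (D : set Y) :=
  forall z, D z <-> exists2 y, D y & K° (y - z).

Definition below (M : set (\bar Y)) : set Y :=
  [set y | exists2 m, M m & ltK K y%:E m].

(** For a lower set [D] this is the weak supremum of [D]; the infinite values are those of
    the degenerate cases [D = Y] and [D = set0]. *)
Definition frontier (D : set Y) : set (\bar Y) :=
  [set v | match v with
           | r%:E => ~ D r /\ forall z, K° (r - z) -> D z
           | +oo%E => D = setT
           | -oo%E => D = set0
           end].

Definition sumset (D1 D2 : set Y) : set Y := [set a + b | a in D1 & b in D2].

Lemma ltKE (a b : Y) : ltK K a%:E b%:E <-> K° (b - a).
Proof.
split=> [[k Ik kab]|I]; first by rewrite -opprB -kab opprK.
by exists (b - a); rewrite ?opprB.
Qed.

Lemma ltKN (u v : \bar Y) : ltK K (- u)%E (- v)%E <-> ltK K v u.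
Proof.
case: u v => [u||] [v||] //;
  rewrite -[(- u%:E)%E]/((- u)%:E) -[(- v%:E)%E]/((- v)%:E).
by rewrite !ltKE opprK addrC.
Qed.

Hypotheses (K_proper : K <> [set: Y]) (K_closed : closed K).
Hypotheses (K_cone : convex_cone K) (K_int : interior K !=set0).

Lemma intK_trans a b c : K° (b - a) -> K (c - b) -> K° (c - a).
Proof.
by move=> Ia Kb; rewrite -(subrKA b c (- a)) addrC; exact: interior_coneD.
Qed.

Lemma intK_transr a b c : K (b - a) -> K° (c - b) -> K° (c - a).
Proof. by move=> Ka Ib; rewrite -(subrKA b c (- a)); exact: interior_coneD. Qed.

Lemma lower_le D y z : lower D -> D y -> K (y - z) -> D z.
Proof.
move=> lD /lD [x Dx xy] yz; apply/lD; exists x => //.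
exact: intK_transr yz xy.
Qed.

Lemma lower_lt D y z : lower D -> D y -> K° (y - z) -> D z.
Proof. by move=> lD Dy yz; apply/lD; exists y. Qed.

Lemma intK_half k : K° k -> K° (2^-1 *: k).
Proof. by apply: (interior_coneZ K_cone); rewrite invr_gt0. Qed.

Lemma halfK (k : Y) : 2^-1 *: k + 2^-1 *: k = k.
Proof.
rewrite -scalerDl (_ : 2^-1 + 2^-1 = 1) ?scale1r//; lra.
Qed.

Lemma lower_below M : lower (below M).
Proof.
move=> z; split=> [[[m||] Mm]|[y [[m||] Mm] ym yz]] //.
(* The midpoint of [z] and [m] lies strictly between them. *)
- move=> /ltKE /intK_half I.
  exists (z + 2^-1 *: (m - z)); last by rewrite addrAC subrr add0r.
  exists m%:E => //; apply/ltKE.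
  by rewrite opprD addrA -{1}(halfK (m - z)) addrK.
- move=> _; have [k Ik] := K_int; exists (z + k).
    by exists +oo%E.
  by rewrite addrAC subrr add0r.
- exists m%:E => //; apply/ltKE; apply: intK_trans yz _.
  by apply: interior_subset; exact/ltKE.
- by exists +oo%E.
Qed.

(** No finite point lies strictly below [-oo]. This allows terms of value [+oo] to be dropped after
    a change of sign. *)
Lemma below_eq M N : (forall m, m <> -oo%E -> (M m <-> N m)) ->
  below M = below N.
Proof.
by move=> MN; apply/seteqP; split=> y [m Mm ym]; exists m => //;
  apply/MN => //; move: ym; case: m {Mm}.
Qed.

(** For finite [v], the two clauses of [WSup] say that [v] is not in [below M] and that every point
    strictly below [v] is. *)
Lemma WSupE M : WSup K M = frontier (below M).
Proof.
apply/seteqP; split=> [[v||] [vM ltM]|[v||]] /=.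
- split=> [[m Mm vm]|z vz]; first exact: vM Mm vm.
  by apply: ltM; exact/ltKE.
- by apply/seteqP; split => // y _; exact: ltM.
- apply/seteqP; split => // y [[m||] Mm ym] //; exact: vM Mm _.
- move=> [nv lv]; split=> [m Mm vm|[u||] //= uv].
  + by apply: nv; exists m.
  + by apply: lv; exact/ltKE.
  (* The value [-oo] is also below [v]; any point of [below M] provides an element of [M] above
     it. *)
  + have [k Ik] := K_int.
    have [|[m||] Mm vm] := lv (v - k); first by rewrite subKr.
      by exists m%:E.
    by exists +oo%E.
    by [].
- move=> MT; split=> [m _ []//|[u||] // _].
    by have : [set: Y] u by []; rewrite -MT.
  have : [set: Y] 0 by []; rewrite -MT => -[[m||] Mm ym]; last by [].
    by exists m%:E.
  by exists +oo%E.
- move=> M0; split=> [[m||] Mm //= _|[]//].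
    have [k Ik] := K_int.
    have : below M (m - k) by exists m%:E => //; apply/ltKE; rewrite subKr.
    by rewrite M0.
  have : below M 0 by exists +oo%E.
  by rewrite M0.
Qed.

(** The segment leaves [D] at the supremum of the parameters [r] with [y + r *: k] in [D]. *)
Lemma frontier_segment D y k t : lower D -> K° k -> 0 <= t ->
  D y -> ~ D (y + t *: k) ->
  exists s, [/\ 0 <= s, s <= t & frontier D (y + s *: k)%:E].
Proof.
move=> lD Ik t0 Dy nDt.
have lineB r s : (y + r *: k) - (y + s *: k) = (r - s) *: k.
  by rewrite opprD addrACA subrr add0r -scalerBl.
have Dmono r s : D (y + r *: k) -> s <= r -> D (y + s *: k).
  move=> Dr; rewrite le_eqVlt => /predU1P[-> //|sr].
  apply: (lower_lt lD Dr); rewrite lineB.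
  by apply: (interior_coneZ K_cone) => //; rewrite subr_gt0.
pose E := [set r | 0 <= r /\ D (y + r *: k)].
have E0 : E 0 by split=> //; rewrite scale0r addr0.
have Et : ubound E t.
  move=> r [r0 Dr]; rewrite leNgt; apply/negP => tr.
  by apply: nDt; exact: Dmono Dr (ltW tr).
have hE : has_sup E by split; [exists 0|exists t].
have supE := ub_le_sup hE.2.
exists (sup E); split; first exact: supE.
  by apply: ge_sup => //; exists 0.
(* By openness, if the crossing point were in [D], so would be the point of parameter
   [sup E + e]. *)
split=> [/lD [z Dz zs]|z zs].
  have [e e0 Ie] := interior_absorbing k zs.
  have : E (sup E + e).
    split; first by rewrite addr_ge0// ?(ltW e0)//; exact: supE.
    by apply: (lower_lt lD Dz); rewrite scalerDl addrA opprD addrA.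
  by move=> /supE; lra.
(* A point strictly below the crossing point is still strictly below the point of parameter
   [sup E - e], which is in [D]. *)
have [e e0 Ie] := interior_absorbing k zs.
have [r [r0 Dr] ser] := sup_adherent e0 hE.
apply: (lower_lt lD (Dmono _ (sup E - e) Dr (ltW ser))).
by rewrite scalerBl [y + _]addrA [_ - z]addrAC.
Qed.

Lemma intK_dominates k z : K° k -> exists2 t : R, 0 < t & K° (t *: k - z).
Proof.
move=> Ik; have [e e0 Ie] := interior_absorbing z Ik.
exists e^-1; first by rewrite invr_gt0.
rewrite -[z in X in K° X](scalerK (lt0r_neq0 e0)) -scalerBr.
by apply: (interior_coneZ K_cone) => //; rewrite invr_gt0.
Qed.

(** Going down from [y] in an interior direction eventually passes below [x], hence enters [D]; the
    frontier is crossed on the way. *)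
Lemma frontier_le D x y : lower D -> D x -> ~ D y ->
  exists2 b, frontier D b%:E & K (y - b).
Proof.
move=> lD Dx nDy; have [k Ik] := K_int.
have [t t0 It] := intK_dominates (y - x) Ik.
have Dt : D (y - t *: k).
  apply: (lower_lt lD Dx); move: It.
  by rewrite !opprB addrCA addrC.
have nDt : ~ D (y - t *: k + t *: k) by rewrite subrK.
have [s [s0 st fs]] := frontier_segment lD Ik (ltW t0) Dt nDt.
exists (y - t *: k + s *: k) => //.
rewrite opprD opprB addrA addrCA subrr addr0 -scalerBl.
move: st; rewrite le_eqVlt => /predU1P[->|st].
  by rewrite subrr scale0r; exact: closed_cone0.
by apply: K_cone.1; rewrite ?subr_gt0//; exact: interior_subset.
Qed.

(** Here the crossing is found going up. Starting from a point [x'] of [D] strictly above [x] makes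
    the inequality strict. *)
Lemma frontier_gt D x y : lower D -> D x -> ~ D y ->
  exists2 b, frontier D b%:E & K° (b - x).
Proof.
move=> lD /lD [x' Dx' xx'] nDy; have [k Ik] := K_int.
have [t t0 It] := intK_dominates (y - x') Ik.
have nDt : ~ D (x' + t *: k).
  move=> Dt; apply: nDy; apply: (lower_lt lD Dt); move: It.
  by rewrite opprB addrA [x' + _]addrC.
have [s [s0 st fs]] := frontier_segment lD Ik (ltW t0) Dx' nDt.
exists (x' + s *: k) => //; rewrite addrAC.
move: s0; rewrite le_eqVlt => /predU1P[<-|s0]; first by rewrite scale0r addr0.
apply: interior_coneD => //; apply: K_cone.1 => //; exact: interior_subset.
Qed.

(** An open lower set is recovered from its weak supremum; the value [+oo] takes care of
    [D = setT]. *)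
Lemma below_frontier D : lower D -> below (frontier D) = D.
Proof.
move=> lD; apply/seteqP; split=> [y [[m||] /= Fm ym]|y Dy] //.
- by apply: Fm.2; exact/ltKE.
- by rewrite Fm.
have [[z nDz]|DT] := pselect (exists z, ~ D z).
  have [b Fb by_] := frontier_gt lD Dy nDz.
  by exists b%:E => //; exact/ltKE.
exists +oo%E => //=; apply/seteqP; split=> // z _; apply: contrapT => nDz.
by apply: DT; exists z.
Qed.

Lemma below_sum_set U V : below (sum_set U V) = sumset (below U) (below V).
Proof.
have [k Ik] := K_int.
have below_fin M m : M m%:E -> forall j, K° j -> below M (m - j).
  by move=> Mm j Ij; exists m%:E => //; apply/ltKE; rewrite subKr.
apply/seteqP; split=> y.
  move=> [_ [[u||] Uu [[v||] Vv <-]]] //.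
  (* Each summand gives up half of the gap [u + v - y]. *)
  - rewrite -[(_ + _)%E]/((u + v)%:E) => /ltKE /intK_half Iy.
    exists (u - 2^-1 *: (u + v - y)); first exact: below_fin.
    exists (v - 2^-1 *: (u + v - y)); first exact: below_fin.
    by rewrite addrACA -opprD halfK subKr.
  (* Every point is below [+oo], so the other summand is free to make the sum equal to [y]. *)
  - move=> _; exists (u - k); first exact: below_fin.
    by exists (y - (u - k)); [exists +oo%E|rewrite addrCA subrr addr0].
  - move=> _; exists (y - (v - k)); first by exists +oo%E.
    by exists (v - k); [exact: below_fin|rewrite subrK].
  - by move=> _; exists 0; [exists +oo%E|exists y; [exists +oo%E|rewrite add0r]].
move=> [a [u Uu au] [b [v Vv bv] <-]].
exists (u + v)%E; first by exists u => //; exists v.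
case: u v au bv {Uu Vv} => [u||] [v||] // au bv.
rewrite -[(_ + _)%E]/((u + v)%:E); apply/ltKE; rewrite opprD addrACA.
apply: interior_coneD; [exact: K_cone|exact/ltKE|].
by apply: interior_subset; exact/ltKE.
Qed.

Lemma lower_sumset D1 D2 : lower D1 -> lower D2 -> lower (sumset D1 D2).
Proof.
move=> l1 l2; rewrite -(below_frontier l1) -(below_frontier l2) -below_sum_set.
exact: lower_below.
Qed.

Lemma uplus_frontier D1 D2 : lower D1 -> lower D2 ->
  uplus K (frontier D1) (frontier D2) = frontier (sumset D1 D2).
Proof. by move=> l1 l2; rewrite /uplus WSupE below_sum_set !below_frontier. Qed.

(** The point [x] excludes [D = set0], where the equivalence fails because the frontier has no
    finite point. *)
Lemma sum_frontier_KE D x y : lower D -> D x ->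
  sum_set (frontier D) (EFin @` K) y%:E <-> ~ D y.
Proof.
move=> lD Dx; split=> [[[u||] Fu [_ [k Kk <-] //]] [<-] Dy|nDy].
  by apply: Fu.1; apply: (lower_le lD Dy); rewrite addrAC subrr add0r.
have [b Fb Kb] := frontier_le lD Dx nDy.
exists b%:E => //; exists (y - b)%:E; first by exists (y - b).
by congr EFin; rewrite addrCA subrr addr0.
Qed.

(** The pieces of the partition are [D], its frontier and the points strictly above the frontier;
    [x] and [y] exclude infinite values. *)
Lemma Pp_frontier D x y : lower D -> D x -> ~ D y ->
  exists2 U, Pp K U & frontier D = EFin @` U.
Proof.
move=> lD Dx nDy.
have I0 := interior_cone0 K_cone K_proper.
exists [set r | frontier D r%:E]; last first.
  apply/seteqP; split=> [[r||] Fr|_ [r Fr <-] //].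
  - by exists r.
  - by case: nDy; rewrite (Fr : D = setT).
  - by move: Dx; rewrite (Fr : D = set0).
have downD u k : frontier D u%:E -> K° k -> D (u - k).
  by move=> [_ Fu] Ik; apply: Fu; rewrite subKr.
have upD u k : frontier D u%:E -> K° k -> ~ D (u + k).
  move=> [nDu _] Ik Duk; apply: nDu; apply: (lower_lt lD Duk).
  by rewrite addrAC subrr add0r.
split.
- apply/seteqP; split=> // z _.
  have [Dz|nDz] := pselect (D z).
    have [b Fb zb] := frontier_gt lD Dz nDy.
    by left; left; exists b => //; exists (b - z); rewrite ?subKr.
  have [Fz|nFz] := pselect (frontier D z%:E); first by left; right.
  (* Off the frontier, [z] has a point [w] outside [D] strictly below it; a frontier point under [w]
     is then strictly below [z]. *)
  right; have [w zw nDw] : exists2 w, K° (z - w) & ~ D w.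
    apply: contrapT => h; apply: nFz; split=> // w zw; apply: contrapT => nDw.
    by apply: h; exists w.
  have [b Fb wb] := frontier_le lD Dx nDw.
  exists b => //; exists (z - b); last by rewrite addrCA subrr addr0.
  exact: intK_transr wb zw.
- apply/seteqP; split=> // _ [[u Fu [k Ik <-]] [nD _]].
  by apply: nD; exact: downD.
- apply/seteqP; split=> // z [[u Fu [k Ik <-]] [u' Fu' [k' Ik' e]]].
  by apply: (upD _ _ Fu' Ik'); rewrite e; exact: downD.
- apply/seteqP; split=> // z [[nD Dz] [u [nDu _] [k Ik e]]].
  by apply: nDu; apply: Dz; rewrite -e addrAC subrr add0r.
Qed.

(** Converse of [Pp_frontier]: the lower set is [U - K°], and the partition makes [U] its
    frontier. *)
Lemma frontier_Pp U : Pp K U ->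
  exists D, [/\ lower D, EFin @` U = frontier D, D <> set0 & D <> setT].
Proof.
move=> [UT dU dUp dUU].
have [k Ik] := K_int.
pose D := [set u - k | u in U & k in K°].
have dis (A B : set Y) z : A `&` B = set0 -> A z -> B z -> False.
  by move=> AB Az Bz; have : (A `&` B) z by []; rewrite AB.
have lD : lower D.
  move=> z; split=> [[u Uu [j Ij <-]]|[_ [u Uu [j Ij <-]] Iz]].
    exists (u - 2^-1 *: j).
      by exists u => //; exists (2^-1 *: j) => //; exact: intK_half.
    by rewrite opprB addrC addrA subrK -{1}(halfK j) addrK; exact: intK_half.
  exists u => //; exists (u - z); last by rewrite subKr.
  apply: intK_trans Iz _; rewrite subKr; exact: interior_subset.
have UD u : U u -> ~ D u by move=> Uu Du; exact: (dis _ _ u dU).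
have U0 : U !=set0.
  have : [set: Y] 0 by [].
  by rewrite -UT => -[[[u Uu _]|]|[u Uu _]]; [exists u|exists 0|exists u].
have [u Uu] := U0.
exists D; split=> //.
- apply/seteqP; split=> [_ [r Ur <-]|[r||]] /=.
  + split; first exact: UD.
    by move=> z rz; exists r => //; exists (r - z) => //; rewrite subKr.
  + move=> [nDr Dr]; exists r => //.
    have : [set: Y] r by []; rewrite -UT => -[[//|//]|[v Uv [j Ij e]]].
    by case: (UD v Uv); apply: Dr; rewrite -e addrAC subrr add0r.
  + by move=> DT; case: (UD u Uu); rewrite DT.
  + move=> D0; have : D (u - k) by exists u => //; exists k.
    by rewrite D0.
- by move=> D0; have : D (u - k) by [exists u => //; exists k]; rewrite D0.
- by move=> DT; case: (UD u Uu); rewrite DT.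
Qed.

(** A point of [D1] outside [D2] has a frontier point of [D2] under it, which is then in [D1] and
    strictly below a frontier point of [D1]. *)
Lemma preceqK_frontier D1 D2 x y : lower D1 -> lower D2 -> D2 x -> ~ D2 y ->
  preceqK K (frontier D1) (frontier D2) <-> D1 `<=` D2.
Proof.
move=> l1 l2 D2x nD2y; split=> [h z D1z|D12].
  apply: contrapT => nD2z; have [b Fb bz] := frontier_le l2 D2x nD2z.
  have := lower_le l1 D1z bz; rewrite -{1}(below_frontier l1) => -[m Fm bm].
  exact: h Fm Fb bm.
move=> [u||] [v||] Fu Fv vu //.
- by apply: Fv.1; apply: D12; apply: Fu.2; exact/ltKE.
- by move: D2x; rewrite (Fv : D2 = set0).
- by apply: Fv.1; apply: D12; rewrite (Fu : D1 = setT).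
- by move: D2x; rewrite (Fv : D2 = set0).
Qed.

End LowerSets.

(** * Strong duality as a covering property *)

Section Duality.
Context (R : realType) (Y : tvsType R) (K : set Y).
Hypotheses (K_proper : K <> [set: Y]) (K_closed : closed K).
Hypotheses (K_cone : convex_cone K) (K_int : interior K !=set0).

Lemma WInfE M : WInf K M = -%E @` frontier K (below K (-%E @` M)).
Proof. by rewrite /WInf WSupE. Qed.

Lemma WMaxP B v : WMax K B v <-> B v /\ forall m, B m -> ~ ltK K v m.
Proof.
split=> [[Bv [vB _]] //|[Bv vB]]; split=> //; split=> // u uv.
by exists v.
Qed.

Lemma frontierT : frontier K setT = [set +oo%E].
Proof.
apply/seteqP; split=> [[r [nT]|//|T0]|_ ->//]; first by case: nT.
by have : [set: Y] 0 by []; rewrite (T0 : setT = set0).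
Qed.

Section Family.
Context (J : Type) (T : set J) (N : J -> set Y) (D : set Y).
Hypotheses (lD : lower K D) (lN : forall j, lower K (N j)) (D_ne : D !=set0).
Hypothesis sDN : forall j, T j -> D `<=` N j.

Let B := \bigcup_(j in T) (-%E @` frontier K (N j)).

Lemma strong_duality_of_cover : T !=set0 ->
  (forall y, ~ D y -> exists2 j, T j & ~ N j y) ->
  -%E @` frontier K D = WMax K B.
Proof.
move=> [j0 Tj0] cover; have [x0 Dx0] := D_ne.
(* If [D = setT], every [N j] is [setT] as well, and the index [j0] puts [-oo] in [B]. *)
have [DT|nDT] := pselect (D = setT).
  have BE : B = [set -oo%E].
    have NT j : T j -> N j = setT.
      by move=> Tj; apply/seteqP; split=> // y _; apply: (sDN Tj); rewrite DT.
    apply/seteqP; split=> [_ [j Tj [b + <-]]|_ ->].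
      by rewrite NT// frontierT => ->.
    by exists j0 => //; exists +oo%E => //=; exact: NT.
  rewrite DT frontierT image_set1 BE; apply/seteqP; split=> [_ ->|v [-> //]].
  by apply/WMaxP; split=> // _ ->.
have [y0 nDy0] : exists y, ~ D y.
  apply: contrapT => h; apply: nDT; apply/seteqP; split=> // y _.
  by apply: contrapT => nDy; apply: h; exists y.
(* A point [y] outside [D] yields a finite dual value that is at least [- y]. *)
have Bfin y : ~ D y -> exists2 c, B (- c%:E)%E & K (y - c).
  move=> /cover [j Tj nNy].
  have [c Fc Kc] :=
    frontier_le K_closed K_cone K_int (lN j) (sDN Tj Dx0) nNy.
  by exists c => //; exists j => //; exists c%:E.
apply/seteqP; split=> [_ [[b||] Fb <-]|v /WMaxP [[j Tj [[b||] Fb <-]] vmax]].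
- have [j Tj nNb] := cover _ Fb.1.
  apply/WMaxP; split.
    exists j => //; exists b%:E => //; split=> // z /Fb.2.
    exact: sDN.
  (* A dual value [- c] strictly above [- b] would put [c] in [D], hence in [N i], of which it is a
     frontier point. *)
  move=> _ [i Ti [[c||] Fc <-]]; rewrite ltKN //.
  + by move=> /ltKE /Fb.2 /(sDN Ti); exact: Fc.1.
  + by move: (sDN Ti Dx0); rewrite (Fc : N i = set0).
- by case: nDT.
- by move: Dx0; rewrite (Fb : D = set0).
- exists b%:E => //; split; first by move/(sDN Tj); exact: Fb.1.
  move=> z bz; apply: contrapT => nDz; have [c Bc zc] := Bfin z nDz.
  apply: (vmax _ Bc); apply/ltKN; apply/ltKE.
  exact: (intK_transr K_cone zc bz).
(* The value [-oo] is not maximal, since there is a finite dual value. *)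
- have [c Bc _] := Bfin y0 nDy0.
  by case: (vmax _ Bc).
- by move: (sDN Tj Dx0); rewrite (Fb : N j = set0).
Qed.

(** A frontier point of [D] under [y] is a frontier point of some [N j], so [N j] cannot contain
    [y]. *)
Lemma cover_of_strong_duality : -%E @` frontier K D = WMax K B ->
  forall y, ~ D y -> exists2 j, T j & ~ N j y.
Proof.
move=> DB y nDy; have [x0 Dx0] := D_ne.
have [b Fb yb] := frontier_le K_closed K_cone K_int lD Dx0 nDy.
have : (-%E @` frontier K D) (- b%:E)%E by exists b%:E.
rewrite DB => /WMaxP [[j Tj [[c||] //= Fc [cb]]] _]; exists j => // Ny.
by apply: Fc.1; rewrite (oppr_inj cb); exact: (lower_le K_cone (lN j) Ny).
Qed.

End Family.

(** * Conjugates and epigraphs in terms of open lower sets *)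

Section Conjugates.
Context (X : tvsType R).
Implicit Types (E : X -> \bar Y) (L : clinear X Y).

Definition conj_below E L : set Y :=
  below K [set ((L x)%:E - E x)%E | x in [set: X]].

Lemma lower_conj_below E L : lower K (conj_below E L).
Proof. exact: lower_below. Qed.

Lemma conjE E L : conj K E L = frontier K (conj_below E L).
Proof. exact: WSupE. Qed.

Lemma conj_below_ne E L x r : E x = r%:E -> conj_below E L !=set0.
Proof.
move=> Ex; have [k Ik] := K_int; exists (L x - r - k).
by exists (L x - r)%:E; [exists x => //; rewrite Ex|apply/ltKE; rewrite subKr].
Qed.

Lemma domconjE E L : domconj K E L <-> exists y, ~ conj_below E L y.
Proof.
rewrite /domconj /= conjE; split=> [h|[y ny] h].
  apply: contrapT => h'; apply: h; rewrite -frontierT; congr (frontier K _).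
  apply/seteqP; split=> // y _; apply: contrapT => ny.
  by apply: h'; exists y.
have : frontier K (conj_below E L) +oo%E by rewrite h.
by move=> /= eT; apply: ny; rewrite eT.
Qed.

Lemma epiconjE E : (exists x r, E x = r%:E) ->
  epiconj K E = [set p | ~ conj_below E p.1 p.2].
Proof.
move=> [x [r Ex]]; apply/seteqP; split=> -[L y];
  have [z Ez] := conj_below_ne L Ex; rewrite /epiconj /= conjE;
  by rewrite (sum_frontier_KE K_closed K_cone K_int y (lower_conj_below E L) Ez).
Qed.

Lemma clinearD0 L : clinearD L (clinear0 X Y) = L.
Proof. by apply: clinear_eq => x; exact: addr0. Qed.

(* A point [y] outside the sum set lies above one of its frontier points [b];
   translating [conj_below E L] by [y - b] puts [y] itself on the frontier. *)
Lemma PsiS_boxplus_EpiconjE E D0 : (exists x r, E x = r%:E) ->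
  lower K D0 -> D0 !=set0 ->
  PsiS (boxplus K (Epiconj K E) [set (clinear0 X Y, frontier K D0)]) =
  [set p | ~ sumset (conj_below E p.1) D0 p.2].
Proof.
move=> [x [r Ex]] l0 [d0 Dd0]; apply/seteqP; split=> -[L y] /=.
  move=> [_ [[L' V] [domL [U /= [PU -> pre]]] [_ -> <-]]] [/= -> {L}].
  rewrite clinearD0; have [D [lD eD D0' DT]] := frontier_Pp K_cone K_int PU.
  move: pre; rewrite eD conjE.
  have /set0P[x1 Dx1] : D != set0 by apply/eqP.
  have /setTPn[y1 nDy1] : D != setT by apply/eqP.
  move=> /(preceqK_frontier K_closed K_cone K_int
    (lower_conj_below E L') lD Dx1 nDy1) ED.
  rewrite uplus_frontier// => -[nDy _] [a Ea [b Db ab]].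
  by apply: nDy; exists a; [exact: ED|exists b].
move=> nNy; have [z0 Ez0] := conj_below_ne L Ex.
have lE := lower_conj_below E L.
have lN := lower_sumset K_cone K_int lE l0.
have [|b Fb Kb] := frontier_le K_closed K_cone K_int lN _ nNy (x := z0 + d0).
  by exists z0 => //; exists d0.
have [k Kk bE] : exists2 k, K k & b = y - k.
  by exists (y - b); rewrite ?subKr.
rewrite {}bE in Fb {Kb}.
pose D := [set z | conj_below E L (z - k)].
have lD : lower K D.
  move=> z; rewrite /D /=; split=> [/lE [w Ew wz]|[w Ew wz]].
    exists (w + k); first by rewrite addrK.
    by move: wz; rewrite opprB addrA.
  by apply/lE; exists (w - k) => //; rewrite opprB subrKA.
have ED : conj_below E L `<=` D.
  by move=> z Ez; apply: (lower_le K_cone lE Ez); rewrite subKr.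
have Dz0 := ED _ Ez0.
(* Otherwise [y - k], a frontier point of the sum set, would belong to it. *)
have nDy : ~ D (y - d0).
  move=> Dy; apply: Fb.1; exists (y - d0 - k) => //; exists d0 => //.
  by rewrite addrAC subrK.
have [U PU eU] := Pp_frontier K_proper K_closed K_cone K_int lD Dz0 nDy.
exists (L, uplus K (frontier K D) (frontier K D0)).
  exists (L, frontier K D).
    split.
      apply/domconjE; exists (y - d0) => Ey; apply: nDy; exact: ED.
    exists U; split=> //=; rewrite conjE.
    exact/(preceqK_frontier K_closed K_cone K_int lE lD Dz0 nDy).
  exists (clinear0 X Y, frontier K D0) => //=.
  by rewrite clinearD0.
split=> //=; rewrite uplus_frontier//.
have shift z : sumset D D0 z <-> sumset (conj_below E L) D0 (z - k).
  split=> [[a Ea [d Dd <-]]|[a Ea [d Dd e]]].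
    by exists (a - k) => //; exists d => //; rewrite addrAC.
  exists (a + k); first by rewrite /D/= addrK.
  by exists d => //; rewrite addrAC e subrK.
split=> [/shift|z yz]; first exact: Fb.1.
by apply/shift; apply: Fb.2; rewrite opprB subrKA.
Qed.

End Conjugates.

(** Common form of both equivalences, which differ only in the multipliers [T] and the lower sets
    [N]. *)
Lemma stable_strong_duality_iff (X : tvsType R) (E : X -> \bar Y)
    (J : Type) (T : set J) (N : J -> clinear X Y -> set Y)
    (M : set (clinear X Y * Y)) :
  (exists x r, E x = r%:E) -> (forall j L, lower K (N j L)) ->
  (forall j L, T j -> conj_below E L `<=` N j L) ->
  domconj K E !=set0 \/ T !=set0 ->
  M = [set p | exists2 j, T j & ~ N j p.1 p.2] ->
  epiconj K E = M <->
  forall L, -%E @` frontier K (conj_below E L) =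
            WMax K (\bigcup_(j in T) (-%E @` frontier K (N j L))).
Proof.
move=> Efin lN EN Tne ->; have [x [r Ex]] := Efin.
have lE L := lower_conj_below E L.
have E_ne L := conj_below_ne L Ex.
rewrite epiconjE//; split=> [eM L|strong].
  have cover L' y : ~ conj_below E L' y -> exists2 j, T j & ~ N j L' y.
    by move=> nEy; move/seteqP: eM => [+ _] => /(_ (L', y) nEy).
  apply: strong_duality_of_cover => //.
  - by move=> j; exact: EN.
  (* If the conjugate of [E] has a point in its domain, the covering at that point itself produces a
     multiplier. *)
  - case: Tne => // -[L0 /domconjE [y /cover [j Tj _]]]; by exists j.
  - exact: cover.
apply/seteqP; split=> -[L y] /=.
  exact: (cover_of_strong_duality (lE L) (fun j => lN j L) (E_ne L) (strong L)).
by move=> [j Tj nNy] Ey; apply: nNy; exact: EN.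
Qed.

End Duality.

(** * The composite problem and its two Lagrange duals *)

Section CompositeDuality.
Context (R : realType) (X Y Z W : tvsType R).
Variables (K : set Y) (P : set W) (S : set Z).
Variables (F : X -> \bar Y) (kappa : W -> \bar Y).
Variables (H : X -> \bar W) (G : X -> \bar Z) (C : set X).
Hypotheses (K_proper : K <> [set: Y]) (K_closed : closed K).
Hypotheses (K_cone : convex_cone K) (K_int : interior K !=set0).
Hypotheses (S_ne : S !=set0) (F_proper : proper_map F).
Hypotheses (kappa_proper : proper_map kappa).
Hypotheses (H_proper : proper_map H) (G_proper : proper_map G).
Hypothesis nonempty :
  feasible S G C `&` dom F `&` preimage_ext H (dom kappa) !=set0.

Let E := primal_map S F kappa H G C.
Let ell := lagrange_map F H G C.

Lemma proper_mapP (T V : Type) (f : T -> \bar V) t : proper_map f ->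
  f t = +oo%E \/ exists v, f t = v%:E.
Proof. by move=> [/(_ t)]; case: (f t) => [v||] //; [right; exists v|left]. Qed.

Lemma comp_kappaP x : comp_ext kappa H x = +oo%E \/
  exists h k, [/\ H x = h%:E, kappa h = k%:E & comp_ext kappa H x = k%:E].
Proof.
rewrite /comp_ext; case: (H x) => [h||]; [|by left|by left].
have [->|[k kh]] := proper_mapP h kappa_proper; first by left.
by right; exists h, k.
Qed.

Lemma primal_mapE x : feasible S G C x ->
  E x = (F x + comp_ext kappa H x + 0%:E)%E.
Proof. by move=> Ax; rewrite /E /primal_map /indic_ext mem_set. Qed.

Lemma primal_map_oo x : ~ feasible S G C x -> E x = +oo%E.
Proof.
move=> nAx; rewrite /E /primal_map /indic_ext memNset//.
have [->|[f ->]] := proper_mapP x F_proper;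
  by have [->|[h [k [_ _ ->]]]] := comp_kappaP x.
Qed.

(** A change of sign turns the objective into the expression under the conjugate; infeasible points
    contribute only [-oo]. *)
Lemma primal_value_conj L :
  primal_value K S F kappa H G C L = -%E @` frontier K (conj_below K E L).
Proof.
rewrite /primal_value WInfE//; congr (-%E @` frontier K _).
apply: below_eq => m m_oo.
have opp_sub (a : \bar Y) (l : Y) : (- (a - l%:E) = l%:E - (a + 0%:E))%E.
  by case: a => [a||] //; congr EFin; rewrite addr0 opprB.
split=> [[_ [x Ax <-] <-]|[x _ xm]].
  by exists x => //; rewrite opp_sub primal_mapE.
have [Ax|nAx] := pselect (feasible S G C x).
  by rewrite -xm primal_mapE// -opp_sub; eexists; first by exists x.
by case: m_oo; rewrite -xm primal_map_oo.
Qed.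

(* On the domain of [primal_map], [w = H x] and [s = - G x] are admissible in
   the infima defining the dual problems. *)
Lemma primal_finite L y : conj_below K E L y ->
  exists x f h s k, [/\ C x, S s,
    [/\ F x = f%:E, H x = h%:E, G x = (- s)%:E & kappa h = k%:E] &
    K° (L x - (f + k) - y)].
Proof.
move=> [_ [x _ <-]]; have [Ax|nAx] := pselect (feasible S G C x); last first.
  by rewrite primal_map_oo.
have [Cx [_ [s Ss <-] Gx]] := Ax; rewrite primal_mapE//.
have [->|[f Fx]] := proper_mapP x F_proper.
  by have [->|[h [k [_ _ ->]]]] := comp_kappaP x.
rewrite Fx; have [->//|[h [k [Hx kh ->]]]] := comp_kappaP x.
rewrite -[X in ltK _ _ X]/((L x - (f + k + 0))%:E) addr0 => /ltKE I.
by exists x, f, h, s, k.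
Qed.

Definition dual_below (T : clinear W Y * clinear Z Y) (L : clinear X Y) :=
  below K (-%E @` [set e | exists x w s, [/\ C x, S s &
      e = (F x - (L x)%:E + compl_ext T.1 H x + compl_ext T.2 G x
           + kappa w - (T.1 w)%:E + (T.2 s)%:E)%E]]).

Definition loose_dual_below (T : clinear W Y * clinear Z Y)
    (L : clinear X Y) :=
  below K (-%E @` [set e | exists x w, C x /\
      e = (F x - (L x)%:E + compl_ext T.1 H x + compl_ext T.2 G x
           + kappa w - (T.1 w)%:E)%E]).

Lemma dual_setE L : dual_set K S F kappa H G C L =
  \bigcup_(T in domconj K kappa `*` Lplusw S K)
    (-%E @` frontier K (dual_below T L)).
Proof.
rewrite /dual_set -bigcup_setX; apply: eq_bigcupr => T _.
by rewrite WInfE.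
Qed.

Lemma loose_dual_setE L : loose_dual_set K P S F kappa H G C L =
  \bigcup_(T in (domconj K kappa `&` Lplus P K) `*` Lplus S K)
    (-%E @` frontier K (loose_dual_below T L)).
Proof.
rewrite /loose_dual_set -bigcup_setX; apply: eq_bigcupr => T _.
by rewrite WInfE.
Qed.

Lemma lagrange_mapP T1 T2 x :
  ell T1 T2 x = +oo%E \/
  exists f h g, [/\ C x, F x = f%:E, H x = h%:E, G x = g%:E &
                 ell T1 T2 x = (f + T1 h + T2 g)%:E].
Proof.
rewrite /ell /lagrange_map /compl_ext /comp_ext /indic_ext.
have [->|[f ->]] := proper_mapP x F_proper;
have [->|[h ->]] := proper_mapP x H_proper;
have [->|[g ->]] := proper_mapP x G_proper; case: ifPn => [/set_mem Cx|_];
  try by left.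
right; exists f, h, g; split => //; congr EFin; exact: addr0.
Qed.

Lemma loose_dual_term (T1 : clinear W Y) (T2 : clinear Z Y)
    (L : clinear X Y) x f h g w k :
  F x = f%:E -> H x = h%:E -> G x = g%:E -> kappa w = k%:E ->
  (- (F x - (L x)%:E + compl_ext T1 H x + compl_ext T2 G x
           + kappa w - (T1 w)%:E))%E =
  (L x - (f + T1 h + T2 g) + (T1 w - k))%:E.
Proof.
rewrite /compl_ext /comp_ext => -> -> -> ->; congr EFin.
rewrite !opprD !opprK [LHS](ACl (2*(1*3*4)*(6*5)))/=.
by rewrite -!addrA.
Qed.

Lemma loose_dual_termP (T1 : clinear W Y) (T2 : clinear Z Y)
    (L : clinear X Y) x w :
  (F x - (L x)%:E + compl_ext T1 H x + compl_ext T2 G x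
     + kappa w - (T1 w)%:E)%E = +oo%E \/
  exists f h g k, [/\ F x = f%:E, H x = h%:E, G x = g%:E & kappa w = k%:E].
Proof.
rewrite /compl_ext /comp_ext.
have [->|[f ->]] := proper_mapP x F_proper;
have [->|[h ->]] := proper_mapP x H_proper;
have [->|[g ->]] := proper_mapP x G_proper;
have [->|[k ->]] := proper_mapP w kappa_proper; try by left.
by right; exists f, h, g, k.
Qed.

Lemma lagrange_mapE T1 T2 x f h g :
  C x -> F x = f%:E -> H x = h%:E -> G x = g%:E ->
  ell T1 T2 x = (f + T1 h + T2 g)%:E.
Proof.
move=> Cx Fx Hx Gx; have [|] := lagrange_mapP T1 T2 x; last first.
  by move=> [f' [h' [g' [_ + + + ->]]]]; rewrite Fx Hx Gx => -[->] [->] [->].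
by rewrite /ell /lagrange_map /compl_ext /comp_ext /indic_ext Fx Hx Gx mem_set.
Qed.

(** The variables [x] and [w] are independent, so the opposite of the Lagrangian splits into two
    conjugate terms. *)
Lemma loose_dual_belowE T L : loose_dual_below T L =
  sumset (conj_below K (ell T.1 T.2) L) (conj_below K kappa T.1).
Proof.
case: T => T1 T2 /=; rewrite -below_sum_set//; apply: below_eq => m m_oo.
split=> [[_ [x [w [Cx ->]]] xm]|[_ [x _ <-] [_ [w _ <-]] xm]].
  have [e|[f [h [g [k [Fx Hx Gx kw]]]]]] := loose_dual_termP T1 T2 L x w.
    by case: m_oo; rewrite -xm e.
  rewrite -xm (loose_dual_term _ _ _ Fx Hx Gx kw).
  exists ((L x)%:E - ell T1 T2 x)%E; first by exists x.
  exists ((T1 w)%:E - kappa w)%E; first by exists w.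
  by rewrite (lagrange_mapE _ _ Cx Fx Hx Gx) kw.
have [e|[f [h [g [Cx Fx Hx Gx e]]]]] := lagrange_mapP T1 T2 x.
  by case: m_oo; rewrite -xm e.
have [kw|[k kw]] := proper_mapP w kappa_proper.
  by case: m_oo; rewrite -xm e kw.
rewrite -xm e kw; eexists; first by exists x, w.
by rewrite (loose_dual_term _ _ _ Fx Hx Gx kw).
Qed.

Lemma dual_term (T1 : clinear W Y) (T2 : clinear Z Y) (L : clinear X Y)
    x f h g w k s :
  F x = f%:E -> H x = h%:E -> G x = g%:E -> kappa w = k%:E ->
  (- (F x - (L x)%:E + compl_ext T1 H x + compl_ext T2 G x
           + kappa w - (T1 w)%:E + (T2 s)%:E))%E =
  (L x - (f + T1 h + T2 g) + ((T1 w - k) + T2 (- s)))%:E.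
Proof.
move=> Fx Hx Gx kw; have := loose_dual_term T1 T2 L Fx Hx Gx kw.
rewrite linearN; set a := (_ - (T1 w)%:E)%E; case: a => [a||] // [e].
by congr EFin; rewrite addrA -e opprD.
Qed.

(** The third independent variable is [- s], which runs over the domain of the indicator. *)
Lemma dual_belowE T L : dual_below T L =
  sumset (conj_below K (ell T.1 T.2) L)
    (sumset (conj_below K kappa T.1)
            (conj_below K (indic_ext Y (-%R @` S)) T.2)).
Proof.
case: T => T1 T2 /=; rewrite -!below_sum_set//; apply: below_eq => m m_oo.
split=> [[_ [x [w [s [Cx Ss ->]]]] xm]|].
  have [e|[f [h [g [k [Fx Hx Gx kw]]]]]] := loose_dual_termP T1 T2 L x w.
    by case: m_oo; rewrite -xm e.
  rewrite -xm (dual_term _ _ _ _ Fx Hx Gx kw).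
  exists ((L x)%:E - ell T1 T2 x)%E; first by exists x.
  exists (((T1 w)%:E - kappa w) + ((T2 (- s))%:E - 0%:E))%E; last first.
    by rewrite (lagrange_mapE _ _ Cx Fx Hx Gx) kw; congr EFin; rewrite subr0.
  exists ((T1 w)%:E - kappa w)%E; first by exists w.
  exists ((T2 (- s))%:E - 0%:E)%E => //; exists (- s) => //.
  by rewrite /indic_ext mem_set//; exists s.
move=> [_ [x _ <-] [_ [_ [w _ <-] [_ [z _ <-] <-]] xm]].
have [e|[f [h [g [Cx Fx Hx Gx e]]]]] := lagrange_mapP T1 T2 x.
  by case: m_oo; rewrite -xm e.
have [kw|[k kw]] := proper_mapP w kappa_proper.
  by case: m_oo; rewrite -xm e kw.
move: xm; rewrite e kw /indic_ext; case: ifPn => [/set_mem [s Ss <-] <-|_ xm].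
  eexists; first by exists x, w, s.
  by rewrite (dual_term _ _ _ _ Fx Hx Gx kw); congr EFin; rewrite subr0.
by case: m_oo; rewrite -xm.
Qed.

Lemma primal_map_fin : exists x r, E x = r%:E.
Proof.
have [x [[Ax Fx] [h kh Hx]]] := nonempty; exists x; rewrite primal_mapE//.
have [/Fx//|[f ->]] := proper_mapP x F_proper.
rewrite /comp_ext -Hx; have [/kh//|[k ->]] := proper_mapP h kappa_proper.
by exists (f + k + 0).
Qed.

Lemma lagrange_map_fin T1 T2 : exists x r, ell T1 T2 x = r%:E.
Proof.
have [x [[[Cx [g _ Gx]] Fx] [h _ Hx]]] := nonempty; exists x.
have [/Fx//|[f Fxf]] := proper_mapP x F_proper.
by rewrite (lagrange_mapE _ _ Cx Fxf (esym Hx) (esym Gx)); eexists.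
Qed.

Lemma conj_below_kappa_ne T1 : conj_below K kappa T1 !=set0.
Proof.
have [_ [w kw]] := kappa_proper.
by have [/kw//|[k]] := proper_mapP w kappa_proper; exact: conj_below_ne.
Qed.

Lemma conj_below_indic_ne T2 :
  conj_below K (indic_ext Y (-%R @` S)) T2 !=set0.
Proof.
have [s Ss] := S_ne; apply: (conj_below_ne K_int T2 (x := - s) (r := 0)).
by rewrite /indic_ext mem_set//; exists s.
Qed.

Lemma M1E : M1 K S F kappa H G C =
  [set p | exists2 T, (domconj K kappa `*` Lplusw S K) T &
     ~ dual_below T p.1 p.2].
Proof.
have term T1 T2 : PsiS (boxplus K (Epiconj K (ell T1 T2))
    [set (clinear0 X Y, uplus K (conj K kappa T1)
                         (conj K (indic_ext Y (-%R @` S)) T2))]) =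
    [set p | ~ dual_below (T1, T2) p.1 p.2].
  have lk := lower_conj_below K_cone K_int kappa T1.
  have li := lower_conj_below K_cone K_int (indic_ext Y (-%R @` S)) T2.
  rewrite !conjE// uplus_frontier//.
  rewrite (PsiS_boxplus_EpiconjE K_proper K_closed K_cone K_int
    (lagrange_map_fin T1 T2)).
  - by apply/seteqP; split=> p /=; rewrite dual_belowE.
  - exact: lower_sumset.
  - have [a ka] := conj_below_kappa_ne T1.
    have [b ib] := conj_below_indic_ne T2.
    by exists (a + b); exists a => //; exists b.
apply/seteqP; split=> [p [T1 dT1 [T2 dT2]]|p [[T1 T2] [dT1 dT2] np]].
  by rewrite term => np; exists (T1, T2).
by exists T1 => //; exists T2 => //; rewrite term.
Qed.

Lemma M1plusE : M1plus K P S F kappa H G C =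
  [set p | exists2 T, ((domconj K kappa `&` Lplus P K) `*` Lplus S K) T &
     ~ loose_dual_below T p.1 p.2].
Proof.
have term T1 T2 : PsiS (boxplus K (Epiconj K (ell T1 T2))
    [set (clinear0 X Y, conj K kappa T1)]) =
    [set p | ~ loose_dual_below (T1, T2) p.1 p.2].
  rewrite conjE// (PsiS_boxplus_EpiconjE K_proper K_closed K_cone K_int
    (lagrange_map_fin T1 T2)).
  - by apply/seteqP; split=> p /=; rewrite loose_dual_belowE.
  - exact: lower_conj_below.
  - exact: conj_below_kappa_ne.
apply/seteqP; split=> [p [T1 dT1 [T2 dT2]]|p [[T1 T2] [dT1 dT2] np]].
  by rewrite term => np; exists (T1, T2).
by exists T1 => //; exists T2 => //; rewrite term.
Qed.

(** Weak duality: at [w = H x] and [s = - G x] the multiplier terms cancel. *)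
Lemma conj_sub_dual T L : conj_below K E L `<=` dual_below T L.
Proof.
move=> y /primal_finite [x [f [h [s [k [Cx Ss [Fx Hx Gx kh] I]]]]]].
exists (L x - (f + k))%:E; last exact/ltKE.
eexists; first by exists x, h, s.
rewrite (dual_term _ _ _ _ Fx Hx Gx kh); congr EFin.
by rewrite !opprD !addrA [LHS](ACl (3*5*(4*7)*(1*2*6)))/= !addNr !add0r.
Qed.

(** Weak duality again: with no variable [s], the term [T.2 s] remains, and it lies in [K] by
    positivity. *)
Lemma conj_sub_loose_dual T L : Lplus S K T.2 ->
  conj_below K E L `<=` loose_dual_below T L.
Proof.
move=> T2S y /primal_finite [x [f [h [s [k [Cx Ss [Fx Hx Gx kh] I]]]]]].
eexists; first by eexists; first by exists x, h.
rewrite (loose_dual_term _ _ _ Fx Hx Gx kh); apply/ltKE.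
have Ks : K (T.2 s) by apply: T2S; exists s.
move: (interior_coneD K_cone I Ks); congr (K° _).
rewrite linearN !opprD !opprK !addrA.
by rewrite [RHS](ACl (3*5*(1*2*6*7*4)))/= addNr add0r.
Qed.

End CompositeDuality.

(** * The zero second multiplier and the two equivalences *)

Lemma clinear0_Lplusw (R : realType) (Y Z : tvsType R) (S : set Z) (K : set Y) :
  ~ K° 0 -> Lplusw S K (clinear0 Z Y).
Proof.
move=> nI; apply/seteqP; split=> // _ [[s _ <-] [k Ik /eqP]].
by rewrite /= oppr_eq0 => /eqP k0; apply: nI; rewrite -k0.
Qed.

Lemma clinear0_Lplus (R : realType) (Y Z : tvsType R) (S : set Z) (K : set Y) :
  K 0 -> Lplus S K (clinear0 Z Y).
Proof. by move=> K0 _ [s _ <-]. Qed.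

(* The premise of each equivalence only discards the case in which both sides
   of the epigraph identity are empty because the dual has no multipliers: the
   identity then reads [set0 = set0], whereas strong duality fails, because
   [WMax set0 = set0] and [WInf] is never empty. *)
Theorem corollary5p1 (R : realType) (X Y Z W : tvsType R)
    (K : set Y) (P : set W) (S : set Z)
    (F : X -> \bar Y) (kappa : W -> \bar Y)
    (H : X -> \bar W) (G : X -> \bar Z) (C : set X)
    (hausX : hausdorff_space X) (hausY : hausdorff_space Y)
    (hausZ : hausdorff_space Z) (hausW : hausdorff_space W)
    (K_proper : K <> [set: Y]) (K_closed : closed K)
    (K_cone : convex_cone K) (K_int : interior K !=set0)
    (P_ne : P !=set0) (P_cone : convex_cone P)
    (S_ne : S !=set0) (S_cone : convex_cone S)
    (F_proper : proper_map F) (kappa_proper : proper_map kappa)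
    (H_proper : proper_map H) (G_proper : proper_map G)
    (C_ne : C !=set0)
    (nonempty : feasible S G C `&` dom F `&` preimage_ext H (dom kappa) !=set0) :
  ((domconj K (primal_map S F kappa H G C) !=set0 \/
    domconj K kappa !=set0) ->
   (epiconj K (primal_map S F kappa H G C) = M1 K S F kappa H G C <->
    stable_strong_duality K S F kappa H G C)) /\
  ((domconj K (primal_map S F kappa H G C) !=set0 \/
    domconj K kappa `&` Lplus P K !=set0) ->
   (epiconj K (primal_map S F kappa H G C) = M1plus K P S F kappa H G C <->
    loose_stable_strong_duality K P S F kappa H G C)).
Proof.
have lower_dual T L : lower K (dual_below K S F kappa H G C T L).
  exact: lower_below.
have lower_loose T L : lower K (loose_dual_below K F kappa H G C T L).
  exact: lower_below.
have fin := primal_map_fin F_proper kappa_proper nonempty.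
split=> ne.
- rewrite (stable_strong_duality_iff K_closed K_cone K_int fin
    lower_dual _ _ (M1E K_proper K_closed K_cone K_int S_ne F_proper
      kappa_proper H_proper G_proper nonempty)).
  + by split=> h L; [rewrite primal_value_conj// dual_setE// h
                    |rewrite -primal_value_conj// -dual_setE// h].
  + by move=> T L _; exact: conj_sub_dual.
  + case: ne => [|[T1 dT1]]; [by left|right; exists (T1, clinear0 Z Y)].
    by split=> //; apply: clinear0_Lplusw; exact: interior_cone0.
- rewrite (stable_strong_duality_iff K_closed K_cone K_int fin
    lower_loose _ _ (M1plusE P K_proper K_closed K_cone K_int F_proper
      kappa_proper H_proper G_proper nonempty)).
  + by split=> h L; [rewrite primal_value_conj// loose_dual_setE// h
                    |rewrite -primal_value_conj// -loose_dual_setE// h].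
  + by move=> T L [_ T2S]; exact: conj_sub_loose_dual.
  + case: ne => [|[T1 dT1]]; [by left|right; exists (T1, clinear0 Z Y)].
    by split=> //; apply: clinear0_Lplus; exact: closed_cone0.
Qed.
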